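(* Let $R=R_0\oplus R_1\oplus\cdots$ be a graded commutative ring with identity, and let $k\ge 1$ be a natural number which is a unit in $R_0$. (1) Let $N=N_0+N_1+\cdots+N_d\in \mathrm{M}_n(R)$ be a nilpotent matrix, where $N_i$ denotes the homogeneous component of $N$ of degree $i$ (the entries of $N_i$ lie in $R_i$). If $[I+N]^k=[I]$ in $\mathrm{SK}_1(R)$, then $[I+N]=[I+N_0]$ in $\mathrm{SK}_1(R)$. (2) In particular, if $R_0$ is a reduced local ring, then $\mathrm{SK}_1(R)$ has no $k$-torsion; that is, if $x\in\mathrm{SK}_1(R)$ satisfies $x^k=1$, then $x=1$.
   Context: ''Graded commutative ring'' means an (ordinary) commutative ring with an $\mathbb{N}$-grading, $R_iR_j\subseteq R_{i+j}$. For a commutative ring $A$ with identity, $\mathrm{GL}(A)=\bigcup_n \mathrm{GL}_n(A)$ and $\mathrm{SL}(A)=\bigcup_n\mathrm{SL}_n(A)$, with $\alpha$ identified with $\begin{pmatrix}\alpha&0\\0&1\end{pmatrix}$; $\mathrm{E}_n(A)$ is the subgroup of $\mathrm{GL}_n(A)$ generated by the elementary matrices $I+\lambda e_{ij}$ ($\lambda\in A$, $i\neq j$), and $\mathrm{E}(A)=\bigcup_n\mathrm{E}_n(A)$. $\mathrm{K}_1(A)=\mathrm{GL}(A)/\mathrm{E}(A)$, an abelian group, and $\mathrm{SK}_1(A)=\mathrm{SL}(A)/\mathrm{E}(A)$ is the kernel of $\det:\mathrm{K}_1(A)\to A^*$. $[\alpha]$ denotes the class of $\alpha\in \mathrm{GL}_n(A)$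 in $\mathrm{K}_1(A)$. *)

(* Defs.v *)
From HB Require Import structures.
From mathcomp Require Import all_boot all_order all_algebra.
From mathcomp Require Import mathcomp_extra boolp classical_sets.

Set Implicit Arguments.
Unset Strict Implicit.
Unset Printing Implicit Defensive.

Import GRing.Theory.
Local Open Scope ring_scope.

(* The general linear group. The base ring is not assumed to have decidable   *)
(* units, so an element of GL_n(A) carries its (unique) inverse.              *)

Section GeneralLinear.
Variable A : comPzRingType.

Definition inverse_pair n : pred ('M[A]_n * 'M[A]_n) :=
  fun p => (p.1 *m p.2 == 1%:M) && (p.2 *m p.1 == 1%:M).

Record GL n := MkGL { GLpair : 'M[A]_n * 'M[A]_n; _ : inverse_pair GLpair }.
HB.instance Definition _ n := [isSub for @GLpair n].
HB.instance Definition _ n := [Choice of GL n by <:].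

Definition GLval n (a : GL n) : 'M[A]_n := (GLpair a).1.
Definition GLinvmx n (a : GL n) : 'M[A]_n := (GLpair a).2.

Lemma GLmulV n (a : GL n) : GLval a *m GLinvmx a = 1%:M.
Proof. by case: a => [[u v] /= uv]; case/andP: (uv) => /eqP. Qed.

Lemma GLmulVl n (a : GL n) : GLinvmx a *m GLval a = 1%:M.
Proof. by case: a => [[u v] /= uv]; case/andP: (uv) => _ /eqP. Qed.

Lemma GLval_inj n : injective (@GLval n).
Proof.
move=> a b eqab; apply: val_inj => /=.
rewrite [GLpair a]surjective_pairing [GLpair b]surjective_pairing.
congr (_, _) => //.
rewrite -/(GLinvmx a) -/(GLinvmx b) -[LHS]mul1mx -(GLmulVl b) -eqab.
by rewrite -mulmxA GLmulV mulmx1.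
Qed.

Lemma mkGL_subproof n (u v : 'M[A]_n) :
  u *m v = 1%:M -> v *m u = 1%:M -> inverse_pair (u, v).
Proof. by move=> uv vu; rewrite /inverse_pair /= uv vu !eqxx. Qed.

Definition mkGL n (u v : 'M[A]_n) (uv : u *m v = 1%:M) (vu : v *m u = 1%:M) :=
  MkGL (mkGL_subproof uv vu).

Definition GLone n : GL n := mkGL (mulmx1 1%:M) (mulmx1 1%:M).

Definition GLinv n (a : GL n) : GL n := mkGL (GLmulVl a) (GLmulV a).

Lemma GLmul_subproof n (a b : GL n) :
  (GLval a *m GLval b) *m (GLinvmx b *m GLinvmx a) = 1%:M /\
  (GLinvmx b *m GLinvmx a) *m (GLval a *m GLval b) = 1%:M.
Proof.
split; first by rewrite mulmxA -(mulmxA (GLval a)) GLmulV mulmx1 GLmulV.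
by rewrite mulmxA -(mulmxA (GLinvmx b)) GLmulVl mulmx1 GLmulVl.
Qed.

Definition GLmul n (a b : GL n) : GL n :=
  mkGL (GLmul_subproof a b).1 (GLmul_subproof a b).2.

End GeneralLinear.

Coercion GLval : GL >-> matrix.

(* Stabilisation: stab p M is the p x p corner of the infinite matrix         *)
(* diag(M, 1, 1, ...), that is diag(M, 1) when n <= p (see stab_block).       *)

Section Stabilisation.
Variable A : comPzRingType.

Definition stab_entry n (M : 'M[A]_n) (i j : nat) : A :=
  match insub i, insub j with
  | Some i', Some j' => M i' j'
  | _, _ => (i == j)%:R
  end.

Definition stab n p (M : 'M[A]_n) : 'M[A]_p :=
  \matrix_(i, j) stab_entry M i j.

Lemma stab_entry_ord n (M : 'M[A]_n) (i j : 'I_n) : stab_entry M i j = M i j.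
Proof. by rewrite /stab_entry !valK. Qed.

Lemma stab_entryl n (M : 'M[A]_n) i j :
  (n <= i)%N -> stab_entry M i j = (i == j)%:R.
Proof. by move=> ni; rewrite /stab_entry insubN // -leqNgt. Qed.

Lemma stab_entryr n (M : 'M[A]_n) i j :
  (n <= j)%N -> stab_entry M i j = (i == j)%:R.
Proof.
by move=> nj; rewrite /stab_entry; case: insubP => // *; rewrite insubN -?leqNgt.
Qed.

Lemma stab_block n m (M : 'M[A]_n) : stab (n + m) M = block_mx M 0 0 1%:M.
Proof.
apply/matrixP=> i j; rewrite mxE.
case: (split_ordP i) => i' ->; case: (split_ordP j) => j' ->.
- by rewrite block_mxEul stab_entry_ord.
- by rewrite block_mxEur stab_entryr ?leq_addr //= mxE ltn_eqF // ltn_addr.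
- by rewrite block_mxEdl stab_entryl ?leq_addr //= mxE gtn_eqF // ltn_addr.
- by rewrite block_mxEdr stab_entryl ?leq_addr //= mxE eqn_add2l.
Qed.

Lemma stab_id n (M : 'M[A]_n) : stab n M = M.
Proof. by apply/matrixP=> i j; rewrite mxE stab_entry_ord. Qed.

Lemma stab_stab n p q (M : 'M[A]_n) :
  (n <= p)%N -> stab q (stab p M) = stab q M.
Proof.
move=> np; apply/matrixP=> i j; rewrite !mxE.
case: (ltnP i p) => [ip|pi]; last first.
  by rewrite stab_entryl // stab_entryl // (leq_trans np).
case: (ltnP j p) => [jp|pj]; last first.
  by rewrite stab_entryr // stab_entryr // (leq_trans np).
by rewrite (stab_entry_ord (stab p M) (Ordinal ip) (Ordinal jp)) mxE.
Qed.

Lemma stab1 n p : stab p (1%:M : 'M[A]_n) = 1%:M.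
Proof.
apply/matrixP=> i j; rewrite !mxE.
case: (ltnP i n) => [ip|pi]; last by rewrite stab_entryl.
case: (ltnP j n) => [jp|pj]; last by rewrite stab_entryr.
by rewrite (stab_entry_ord _ (Ordinal ip) (Ordinal jp)) mxE.
Qed.

Lemma stabM n p (M N : 'M[A]_n) :
  (n <= p)%N -> stab p (M *m N) = stab p M *m stab p N.
Proof.
move/subnKC=> <-; rewrite !stab_block mulmx_block.
by rewrite !mulmx0 !mul0mx !addr0 !add0r mulmx1.
Qed.

Lemma det_stab n p (M : 'M[A]_n) : (n <= p)%N -> \det (stab p M) = \det M.
Proof. by move/subnKC=> <-; rewrite stab_block det_ublock det1 mulr1. Qed.

Lemma GLstab_subproof n p (np : (n <= p)%N) (a : GL A n) :
  stab p a *m stab p (GLinvmx a) = 1%:M /\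
  stab p (GLinvmx a) *m stab p a = 1%:M.
Proof. by rewrite -!stabM // GLmulV GLmulVl stab1. Qed.

Definition GLstab n p (np : (n <= p)%N) (a : GL A n) : GL A p :=
  mkGL (GLstab_subproof np a).1 (GLstab_subproof np a).2.

Lemma GL_oneE n : GLone A n = 1%:M :> 'M[A]_n.
Proof. by []. Qed.

Lemma GL_mulE n (a b : GL A n) : GLmul a b = GLval a *m GLval b :> 'M[A]_n.
Proof. by []. Qed.

Lemma GL_stabE n p (np : (n <= p)%N) (a : GL A n) :
  GLstab np a = stab p a :> 'M[A]_p.
Proof. by []. Qed.

Definition GLE := (GL_oneE, GL_mulE, GL_stabE).

End Stabilisation.

(* The elementary subgroup. The inverse of 1 + x e_ij is 1 - x e_ij, so E_n   *)
(* consists of the products of the generators (see elementary_inv).           *)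

Section Elementary.
Variable A : comPzRingType.

Inductive elementary n : 'M[A]_n -> Prop :=
| elementary1 : elementary 1%:M
| elementary_consl (i j : 'I_n) (x : A) (M : 'M[A]_n) :
    i != j -> elementary M ->
    elementary ((1%:M + x *: delta_mx i j) *m M).

Lemma elementaryM n (M N : 'M[A]_n) :
  elementary M -> elementary N -> elementary (M *m N).
Proof.
elim=> [|i j x M' ij _ IH] eN; first by rewrite mul1mx.
by rewrite -mulmxA; apply: elementary_consl => //; apply: IH.
Qed.

Lemma elementary_gen n (i j : 'I_n) (x : A) :
  i != j -> elementary (1%:M + x *: delta_mx i j).
Proof.
by move=> ij; rewrite -[_ + _]mulmx1; apply: elementary_consl => //; left.
Qed.

Lemma mul_elementary_gen n (i j : 'I_n) (x y : A) : i != j ->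
  (1%:M + x *: delta_mx i j) *m (1%:M + y *: delta_mx i j) =
  1%:M + (x + y) *: delta_mx i j.
Proof.
move=> ij; rewrite mulmxDl mul1mx mulmxDr mulmx1 -scalemxAl -scalemxAr.
by rewrite mul_delta_mx_0 1?eq_sym // !scaler0 addr0 scalerDl -addrA [_ + x *: _]addrC.
Qed.

Lemma elementary_inv n (M : 'M[A]_n) : elementary M ->
  exists N, [/\ elementary N, M *m N = 1%:M & N *m M = 1%:M].
Proof.
elim=> [|i j x M' ij _ [N [eN MN NM]]].
  by exists 1%:M; split; rewrite ?mulmx1 //; left.
exists (N *m (1%:M + (- x) *: delta_mx i j)); split.
- by apply: elementaryM => //; apply: elementary_gen.
- rewrite mulmxA -(mulmxA _ M') MN mulmx1 mul_elementary_gen //.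
  by rewrite subrr scale0r addr0.
- rewrite mulmxA -(mulmxA N) mul_elementary_gen //.
  by rewrite addNr scale0r addr0 mulmx1.
Qed.

Lemma stab_gen n p (np : (n <= p)%N) (i j : 'I_n) (x : A) : i != j ->
  stab p (1%:M + x *: delta_mx i j) =
  1%:M + x *: delta_mx (widen_ord np i) (widen_ord np j).
Proof.
move=> ij; apply/matrixP=> k l; rewrite !mxE.
have out (m : 'I_n) (q : 'I_p) : (n <= q)%N -> (q == widen_ord np m) = false.
  move=> nq; apply/negbTE/eqP => /(congr1 val) /= qm.
  by move: nq; rewrite qm leqNgt ltn_ord.
case: (ltnP k n) => [kn|nk]; last by rewrite stab_entryl // out //= mulr0 addr0.
case: (ltnP l n) => [ln|nl].
  by rewrite (stab_entry_ord _ (Ordinal kn) (Ordinal ln)) !mxE.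
by rewrite stab_entryr // (out j) // andbF mulr0 addr0.
Qed.

Lemma elementary_stab n p (M : 'M[A]_n) :
  (n <= p)%N -> elementary M -> elementary (stab p M).
Proof.
move=> np; elim=> [|i j x M' ij _ IH]; first by rewrite stab1; left.
rewrite stabM // (stab_gen np) //; apply: elementary_consl => //.
Qed.

Lemma det_elementary n (M : 'M[A]_n) : elementary M -> \det M = 1.
Proof.
elim=> [|i j x M' ij _ IH]; first exact: det1.
rewrite det_mulmx IH mulr1.
wlog lt_ij : i j ij / (i < j)%N.
  move=> th; case: (ltngtP i j) => [||/val_inj eij]; first exact: th.
    move=> ji; rewrite -det_tr linearD linearZ /= trmx1 trmx_delta.
    by apply: th => //; rewrite eq_sym.
  by rewrite eij eqxx in ij.
rewrite -det_tr det_trig.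
  by apply: big1 => k _; rewrite !mxE eqxx; case: eqP => [->|_] /=;
    rewrite ?(negPf ij) ?mulr0 ?addr0.
apply/is_trig_mxP => k l lt_kl; rewrite !mxE -val_eqE gtn_eqF //= add0r.
case: eqP => [li|_]; last by rewrite mulr0.
case: eqP => [kj|_]; last by rewrite mulr0.
by move: lt_kl; rewrite li kj ltnNge ltnW.
Qed.

Lemma elementary_ublock n m (X : 'M[A]_(n, m)) :
  elementary (block_mx 1%:M X 0 1%:M).
Proof.
rewrite [X]matrix_sum_delta.
elim/big_ind: _ => [|Y Z eY eZ|i _]; first by rewrite -scalar_mx_block; left.
  have := elementaryM eZ eY.
  by rewrite mulmx_block !mulmx0 !mul0mx !mul1mx !mulmx1 !addr0 !add0r.
elim/big_ind: _ => [|Y Z eY eZ|j _]; first by rewrite -scalar_mx_block; left.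
  have := elementaryM eZ eY.
  by rewrite mulmx_block !mulmx0 !mul0mx !mul1mx !mulmx1 !addr0 !add0r.
have -> : block_mx 1%:M (X i j *: delta_mx i j) 0 1%:M =
    1%:M + X i j *: delta_mx (lshift m i) (rshift n j).
  rewrite scalar_mx_block; apply/matrixP=> k l.
  case: (split_ordP k) => k' ->; case: (split_ordP l) => l' ->;
    rewrite [RHS]mxE !(block_mxEul, block_mxEur, block_mxEdl, block_mxEdr) !mxE;
    by rewrite ?eq_lshift ?eq_rshift ?eq_lrshift ?eq_rlshift ?andbF /=
      ?mulr0 ?addr0 ?add0r.
by apply: elementary_gen; rewrite eq_lrshift.
Qed.

Lemma elementary_tr n (M : 'M[A]_n) : elementary M -> elementary M^T.
Proof.
elim=> [|i j x M' ij _ IH]; first by rewrite trmx1; left.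
rewrite trmx_mul linearD linearZ /= trmx1 trmx_delta.
by apply: elementaryM => //; apply: elementary_gen; rewrite eq_sym.
Qed.

Lemma elementary_lblock n m (X : 'M[A]_(m, n)) :
  elementary (block_mx 1%:M 0 X 1%:M).
Proof.
rewrite -[block_mx _ _ _ _]trmxK; apply: elementary_tr.
by rewrite tr_block_mx !trmx1 trmx0; apply: elementary_ublock.
Qed.

Lemma elementary_whitehead n (u v : 'M[A]_n) :
  u *m v = 1%:M -> v *m u = 1%:M -> elementary (block_mx u 0 0 v).
Proof.
move=> uv vu.
have -> : block_mx u 0 0 v =
   (block_mx 1%:M u 0 1%:M *m block_mx 1%:M 0 (- v) 1%:M *m
    block_mx 1%:M u 0 1%:M) *m
   (block_mx 1%:M (- 1%:M) 0 1%:M *m block_mx 1%:M 0 1%:M 1%:M *m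
    block_mx 1%:M (- 1%:M) 0 1%:M).
  rewrite !mulmx_block !(mulmx0, mul0mx, mulmx1, mul1mx, addr0, add0r).
  rewrite !(mulmxN, mulNmx, mulmx1, mul1mx, uv, vu, subrr, mul0mx, addNr).
  by rewrite !(add0r, addr0, oppr0, opprK, mul0mx, mulmx0, mulmxN, mulmx1).
do !apply: elementaryM; by [apply: elementary_ublock | apply: elementary_lblock].
Qed.

Lemma elementary_conj n (a : GL A n) (e : 'M[A]_n) : elementary e ->
  elementary (stab (n + n) (GLinvmx a *m e *m a)).
Proof.
move=> ee.
have -> : stab (n + n) (GLinvmx a *m e *m a) =
    block_mx (GLinvmx a) 0 0 a *m stab (n + n) e *m block_mx a 0 0 (GLinvmx a).
  rewrite !stab_block !mulmx_block !(mulmx0, mul0mx, mulmx1, addr0, add0r).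
  by rewrite GLmulV.
apply: elementaryM; last exact: elementary_whitehead (GLmulV a) (GLmulVl a).
apply: elementaryM; first exact: elementary_whitehead (GLmulVl a) (GLmulV a).
by apply: elementary_stab; rewrite ?leq_addr.
Qed.

End Elementary.

(* K_1(A) = GL(A) / E(A). A point of GL(A) is represented by a matrix of      *)
(* GL_n(A) for some n, and a E(A) = b E(A) means that stab p a = stab p b * e *)
(* for some size p and some e in E_p(A); in particular diag(a, 1) and a       *)
(* represent the same class (see K1_class_stab).                              *)

Section K1.
Variable A : comPzRingType.

Definition stableGL := {n : nat & GL A n}.
HB.instance Definition _ := Choice.on stableGL.

Definition K1_rel (a b : stableGL) : Prop :=
  exists p, [/\ (tag a <= p)%N, (tag b <= p)%N
    & exists2 e : 'M[A]_p, elementary e &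
      stab p (tagged a) = stab p (tagged b) *m e].

Definition K1_relb : rel stableGL := fun a b => `[< K1_rel a b >].

Lemma K1_rel_ge (a b : stableGL) : K1_rel a b ->
  exists p0, forall p, (p0 <= p)%N -> [/\ (tag a <= p)%N, (tag b <= p)%N
    & exists2 e : 'M[A]_p, elementary e &
      stab p (tagged a) = stab p (tagged b) *m e].
Proof.
case=> q [aq bq [e ee eq_ab]]; exists q => p qp.
split; [exact: leq_trans qp|exact: leq_trans qp|exists (stab p e)].
  exact: elementary_stab.
by rewrite -(stab_stab _ _ aq) eq_ab stabM // stab_stab.
Qed.

Lemma K1_refl : reflexive K1_relb.
Proof.
move=> a; apply/asboolP; exists (tag a); split=> //.
by exists 1%:M; [left|rewrite mulmx1].
Qed.

Lemma K1_sym : symmetric K1_relb.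
Proof.
have th a b : K1_rel a b -> K1_rel b a.
  case=> p [ap bp [e ee eq_ab]]; exists p; split=> //.
  have [f [ef f1 _]] := elementary_inv ee.
  by exists f => //; rewrite eq_ab -mulmxA f1 mulmx1.
by move=> a b; apply/asboolP/asboolP; apply: th.
Qed.

Lemma K1_trans : transitive K1_relb.
Proof.
move=> b a c /asboolP/K1_rel_ge[p ab] /asboolP/K1_rel_ge[q bc].
apply/asboolP; exists (maxn p q).
have [aM bM [e ee ->]] := ab _ (leq_maxl p q).
have [_ cM [f ef ->]] := bc _ (leq_maxr p q).
split=> //; exists (f *m e); first exact: elementaryM.
by rewrite mulmxA.
Qed.

Canonical K1_equiv := EquivRel K1_relb K1_refl K1_sym K1_trans.

Local Open Scope quotient_scope.

Definition K1 := {eq_quot K1_equiv}.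
HB.instance Definition _ := Choice.on K1.
HB.instance Definition _ := EqQuotient.on K1.

Definition K1_class n (a : GL A n) : K1 := \pi_K1 (Tagged (GL A) a).

Lemma K1_classP n m (a : GL A n) (b : GL A m) :
  K1_class a = K1_class b <-> K1_rel (Tagged (GL A) a) (Tagged (GL A) b).
Proof.
by split=> [/eqmodP/asboolP //|ab]; apply/eqmodP/asboolP.
Qed.

Lemma K1_class_surj (x : K1) : exists n (a : GL A n), x = K1_class a.
Proof.
by elim/quotW: x => -[n a]; exists n, a.
Qed.

Lemma K1_class_stab n p (np : (n <= p)%N) (a : GL A n) :
  K1_class (GLstab np a) = K1_class a.
Proof.
apply/K1_classP; exists p; split=> //=; exists 1%:M; first by left.
by rewrite mulmx1 stab_id.
Qed.

Lemma K1_class_eq n (a b : GL A n) : a = b :> 'M[A]_n -> K1_class a = K1_class b.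
Proof. by move/GLval_inj->. Qed.

Lemma K1_class_mul n (a a' b b' : GL A n) :
  K1_class a = K1_class a' -> K1_class b = K1_class b' ->
  K1_class (GLmul a b) = K1_class (GLmul a' b').
Proof.
move=> /K1_classP/K1_rel_ge[p aa] /K1_classP/K1_rel_ge[q bb].
pose r := maxn p q; apply/K1_classP; exists (r + r)%N.
have [/= nr _ [e ee eqa]] := aa _ (leq_maxl p q).
have [/= _ _ [f ef eqb]] := bb _ (leq_maxr p q).
have nrr : (n <= r + r)%N by rewrite (leq_trans nr) ?leq_addr.
split=> //=; pose g := GLstab nr b'.
exists (stab (r + r) (GLinvmx g *m e *m g *m f)).
  rewrite stabM ?leq_addr //; apply: elementaryM; first exact: elementary_conj.
  by apply: elementary_stab; rewrite ?leq_addr.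
rewrite -[LHS](stab_stab _ _ nr) -[X in _ = X *m _](stab_stab _ _ nr).
rewrite !(stabM _ _ nr) eqa eqb -stabM ?leq_addr //; congr (stab _ _).
rewrite !mulmxA; congr (_ *m _).
by rewrite -(mulmxA _ (stab _ b')) (GLmulV g) mulmx1.
Qed.

Lemma K1_class_inv n (a a' : GL A n) :
  K1_class a = K1_class a' -> K1_class (GLinv a) = K1_class (GLinv a').
Proof.
have Vl (c : GL A n) : GLmul (GLinv c) c = GLone A n.
  exact/GLval_inj/GLmulVl.
have Vr (c : GL A n) : GLmul c (GLinv c) = GLone A n.
  exact/GLval_inj/GLmulV.
move=> aa.
have -> : GLinv a = GLmul (GLmul (GLinv a) a') (GLinv a').
  apply: GLval_inj; rewrite -[RHS]/(GLinvmx a *m a' *m GLinvmx a').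
  by rewrite -mulmxA GLmulV mulmx1.
have -> : K1_class (GLmul (GLmul (GLinv a) a') (GLinv a')) =
          K1_class (GLmul (GLmul (GLinv a) a) (GLinv a')).
  by apply: K1_class_mul => //; apply: K1_class_mul.
rewrite Vl; apply: K1_class_eq; exact: mul1mx.
Qed.

Definition sGLmul (a b : stableGL) : stableGL :=
  Tagged (GL A) (GLmul (GLstab (leq_maxl (tag a) (tag b)) (tagged a))
                       (GLstab (leq_maxr (tag a) (tag b)) (tagged b))).

Definition K1_one : K1 := K1_class (GLone A 0).

Definition K1_mul (x y : K1) : K1 := \pi_K1 (sGLmul (repr x) (repr y)).

Definition K1_inv (x : K1) : K1 := K1_class (GLinv (tagged (repr x))).

Lemma K1_class_repr (x : K1) : K1_class (tagged (repr x)) = x.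
Proof. by rewrite -[RHS]reprK /K1_class; case: (repr x). Qed.

Lemma K1_class1 n : K1_class (GLone A n) = K1_one.
Proof.
by rewrite /K1_one -(K1_class_stab (leq0n n)); apply: K1_class_eq; rewrite !GLE stab1.
Qed.

Lemma K1_mulE n (a b : GL A n) :
  K1_mul (K1_class a) (K1_class b) = K1_class (GLmul a b).
Proof.
rewrite /K1_mul; set x := repr _; set y := repr _.
set p := maxn (tag x) (tag y); pose q := maxn n p.
have np : (n <= q)%N by rewrite leq_maxl.
have pq : (p <= q)%N by rewrite leq_maxr.
have xp : (tag x <= p)%N by rewrite leq_maxl.
have yp : (tag y <= p)%N by rewrite leq_maxr.
rewrite -(K1_class_stab np (GLmul a b)) -[LHS](K1_class_stab pq).
transitivity (K1_class (GLmul (GLstab (leq_trans xp pq) (tagged x))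
                              (GLstab (leq_trans yp pq) (tagged y)))).
  by apply: K1_class_eq; rewrite !GLE stabM // !stab_stab.
transitivity (K1_class (GLmul (GLstab np a) (GLstab np b))).
  by apply: K1_class_mul; rewrite !K1_class_stab K1_class_repr.
by apply: K1_class_eq; rewrite !GLE stabM.
Qed.

Lemma K1_invE n (a : GL A n) : K1_inv (K1_class a) = K1_class (GLinv a).
Proof.
rewrite /K1_inv; set x := repr _; pose q := maxn n (tag x).
have np : (n <= q)%N by rewrite leq_maxl.
have xq : (tag x <= q)%N by rewrite leq_maxr.
rewrite -(K1_class_stab np (GLinv a)) -[LHS](K1_class_stab xq).
transitivity (K1_class (GLinv (GLstab xq (tagged x)))); first exact: K1_class_eq.
transitivity (K1_class (GLinv (GLstab np a))); last exact: K1_class_eq.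
by apply: K1_class_inv; rewrite !K1_class_stab K1_class_repr.
Qed.

Lemma K1_class_common (x y z : K1) : exists n (a b c : GL A n),
  [/\ x = K1_class a, y = K1_class b & z = K1_class c].
Proof.
have [n [a ->]] := K1_class_surj x; have [m [b ->]] := K1_class_surj y.
have [p [c ->]] := K1_class_surj z; pose q := maxn n (maxn m p).
have nq : (n <= q)%N by rewrite leq_maxl.
have mq : (m <= q)%N by rewrite /q maxnCA leq_maxl.
have pq : (p <= q)%N by rewrite /q maxnA leq_maxr.
by exists q, (GLstab nq a), (GLstab mq b), (GLstab pq c); rewrite !K1_class_stab.
Qed.

Lemma K1_mulA : associative K1_mul.
Proof.
move=> x y z; have [n [a [b [c [-> -> ->]]]]] := K1_class_common x y z.
by rewrite !K1_mulE; apply: K1_class_eq; rewrite !GLE mulmxA.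
Qed.

Lemma K1_mul1 : left_id K1_one K1_mul.
Proof.
move=> x; have [n [a ->]] := K1_class_surj x.
by rewrite -(K1_class1 n) K1_mulE; apply: K1_class_eq; rewrite !GLE mul1mx.
Qed.

Lemma K1_mulr1 : right_id K1_one K1_mul.
Proof.
move=> x; have [n [a ->]] := K1_class_surj x.
by rewrite -(K1_class1 n) K1_mulE; apply: K1_class_eq; rewrite !GLE mulmx1.
Qed.

Lemma K1_mulV : left_inverse K1_one K1_inv K1_mul.
Proof.
move=> x; have [n [a ->]] := K1_class_surj x.
rewrite K1_invE K1_mulE -(K1_class1 n); apply: K1_class_eq; exact: GLmulVl.
Qed.

Lemma K1_mulrV : right_inverse K1_one K1_inv K1_mul.
Proof.
move=> x; have [n [a ->]] := K1_class_surj x.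
rewrite K1_invE K1_mulE -(K1_class1 n); apply: K1_class_eq; exact: GLmulV.
Qed.

HB.instance Definition _ :=
  isGroup.Build K1 K1_mulA K1_mul1 K1_mulr1 K1_mulV K1_mulrV.

Lemma K1_classM n (a b : GL A n) :
  K1_class (GLmul a b) = (K1_class a * K1_class b)%g.
Proof. by rewrite -K1_mulE. Qed.

Lemma K1_class_one n : K1_class (GLone A n) = 1%g.
Proof. exact: K1_class1. Qed.

Definition SK1 : {pred K1} :=
  fun x => `[< exists n (a : GL A n), \det a = 1 /\ x = K1_class a >].

Lemma SK1E n (a : GL A n) : (K1_class a \in SK1) = (\det a == 1).
Proof.
apply/asboolP/eqP=> [[m [b [db /K1_classP[p [/= np mp [e ee eab]]]]]]|da].
  by rewrite -(det_stab _ np) eab det_mulmx (det_elementary ee) mulr1 det_stab.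
by exists n, a.
Qed.

End K1.
Arguments SK1 A : clear implicits.

Section Unipotent.
Variable A : comPzRingType.

Definition nilpotent_mx n (N : 'M[A]_n) : Prop := exists m, N ^+ m = 0.

Lemma nilpotent_GL n (N : 'M[A]_n) : nilpotent_mx N ->
  exists a : GL A n, a = 1 + N :> 'M[A]_n.
Proof.
case=> m Nm0; pose S := \sum_(i < m) (- N) ^+ i : 'M[A]_n.
have cNS : N * S = S * N.
  rewrite mulr_sumr mulr_suml; apply: eq_bigr => i _.
  exact/commrX/commrN.
have h : (1 + N) * S = 1.
  have := subrX1 (- N) m; rewrite exprNn Nm0 mulr0 sub0r -opprD mulNr.
  by rewrite addrC => /oppr_inj.
have h' : S * (1 + N) = 1 by rewrite mulrDr mulr1 -cNS -[X in X + _]mul1r -mulrDl.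
by exists (@mkGL A n _ _ h h').
Qed.

Definition unipotent n (N : 'M[A]_n) (hN : nilpotent_mx N) : GL A n :=
  sval (cid (nilpotent_GL hN)).

Lemma unipotentE n (N : 'M[A]_n) (hN : nilpotent_mx N) :
  unipotent hN = 1 + N :> 'M[A]_n.
Proof. exact: svalP (cid (nilpotent_GL hN)). Qed.

End Unipotent.

(* 1 is automatically of degree 0, see degree0_subring. *)
Record grading (R : comPzRingType) := Grading {
  degree_part :> nat -> zmodClosed R;
  gradingM : forall i j x y, x \in degree_part i -> y \in degree_part j ->
    x * y \in degree_part (i + j)%N;
  grading_span : forall x : R, exists d (c : nat -> R),
    (forall i, c i \in degree_part i) /\ x = \sum_(i < d) c i;
  grading_direct : forall d (c : nat -> R),
    (forall i, c i \in degree_part i) -> \sum_(i < d) c i = 0 ->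
    forall i, (i < d)%N -> c i = 0
}.

Section Homogeneous.
Variables (R : comPzRingType) (G : grading R).

(* c is the family of homogeneous components of x *)
Definition is_decomposition (x : R) (c : nat -> R) : Prop :=
  (forall i, c i \in G i) /\
  exists d, (forall i, (d <= i)%N -> c i = 0) /\ x = \sum_(i < d) c i.

Lemma decomposition_exists x : exists c, is_decomposition x c.
Proof.
have [d [c [hc ->]]] := grading_span G x.
exists (fun i => if (i < d)%N then c i else 0); split.
  by move=> i; case: ifP => // _; rewrite rpred0.
exists d; split=> [i|]; first by rewrite ltnNge => ->.
by apply: eq_bigr => i _; rewrite ltn_ord.
Qed.

Lemma decomposition_widen (c : nat -> R) d e : (d <= e)%N ->
  (forall i, (d <= i)%N -> c i = 0) -> \sum_(i < e) c i = \sum_(i < d) c i.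
Proof.
move=> de c0; rewrite -!(big_mkord xpredT) (big_cat_nat (n := d)) //=.
by rewrite [X in _ + X]big_nat_cond [X in _ + X]big1 ?addr0 // => i /andP[/andP[/c0]].
Qed.

Lemma decomposition_uniq x c c' :
  is_decomposition x c -> is_decomposition x c' -> c =1 c'.
Proof.
move=> [hc [d [cd ->]]] [hc' [d' [cd' e]]] i.
pose m := maxn i.+1 (maxn d d').
have dm : (d <= m)%N by rewrite /m maxnCA leq_maxl.
have dm' : (d' <= m)%N by rewrite /m maxnA leq_maxr.
apply/eqP; rewrite -subr_eq0; apply/eqP.
apply: (@grading_direct _ G m (fun j => c j - c' j)); last by rewrite leq_maxl.
  by move=> j; rewrite rpredB.
by rewrite sumrB (decomposition_widen dm) // (decomposition_widen dm') // -e subrr.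
Qed.

Definition hcomp (i : nat) (x : R) : R := sval (cid (decomposition_exists x)) i.

Lemma hcompP x : is_decomposition x (hcomp^~ x).
Proof. exact: svalP (cid (decomposition_exists x)). Qed.

Lemma hcomp_uniq x c : is_decomposition x c -> forall i, hcomp i x = c i.
Proof. by move=> hc i; apply: decomposition_uniq hc i; apply: hcompP. Qed.

Lemma hcomp_in i x : hcomp i x \in G i.
Proof. by case: (hcompP x). Qed.

Lemma hcomp_hom i j x : x \in G j -> hcomp i x = if i == j then x else 0.
Proof.
move=> xj; rewrite (@hcomp_uniq x (fun i => if i == j then x else 0)) //.
split=> [l|]; first by case: eqP => [->|_]; rewrite ?rpred0.
exists j.+1; split=> [l jl|]; first by rewrite gtn_eqF.
rewrite big_ord_recr /= eqxx big1 ?add0r // => l _.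
by rewrite ltn_eqF.
Qed.

Lemma hcomp_sub i : {morph hcomp i : x y / x - y}.
Proof.
move=> x y; have [hx [d [xd ex]]] := hcompP x; have [hy [e [ye ey]]] := hcompP y.
rewrite (@hcomp_uniq (x - y) (fun i => hcomp i x - hcomp i y)) //; split.
  by move=> j; rewrite rpredB.
have dm := leq_maxl d e; have em := leq_maxr d e.
exists (maxn d e); split=> [j|].
  by rewrite geq_max => /andP[dj ej]; rewrite xd // ye // subr0.
by rewrite sumrB (decomposition_widen dm) // (decomposition_widen em) // -ex -ey.
Qed.

HB.instance Definition _ i :=
  GRing.isZmodMorphism.Build R R (hcomp i) (@hcomp_sub i).

Lemma hcomp_homM i j x y : x \in G j ->
  hcomp i (x * y) = if (j <= i)%N then x * hcomp (i - j) y else 0.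
Proof.
move=> xj; have [hy [d [yd ey]]] := hcompP y.
apply: (hcomp_uniq (c := fun i => if (j <= i)%N then x * hcomp (i - j) y else 0)).
split=> [l|].
  by case: leqP => [jl|_]; rewrite ?rpred0 // -[X in G X](subnKC jl) gradingM.
exists (j + d)%N; split=> [l jdl|].
  by case: leqP => // jl; rewrite yd ?mulr0 // leq_subRL.
rewrite big_split_ord /= big1 ?add0r => [|l _]; last by rewrite leqNgt ltn_ord.
rewrite {1}ey mulr_sumr; apply: eq_bigr => l _.
by rewrite leq_addr addKn.
Qed.

Lemma hcomp0_1 : hcomp 0 1 = 1.
Proof.
have hom j x : x \in G j -> x * hcomp 0 1 = x.
  move=> xj; have := hcomp_homM j 1 xj.
  by rewrite mulr1 leqnn subnn (hcomp_hom j xj) eqxx.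
rewrite -[LHS]mul1r; have [h1 [d [_ {1 3}->]]] := hcompP 1.
by rewrite mulr_suml; apply: eq_bigr => i _; apply: hom (h1 i).
Qed.

Lemma hcomp0M : {morph hcomp 0 : x y / x * y}.
Proof.
move=> x y; have [hx [d [xd {1}->]]] := hcompP x.
rewrite mulr_suml raddf_sum /=.
under eq_bigr => i _ do rewrite (hcomp_homM 0 y (hx i)).
case: d xd => [|d] xd; first by rewrite big_ord0 xd // mul0r.
by rewrite big_ord_recl /= big1 ?addr0.
Qed.

HB.instance Definition _ :=
  GRing.isMonoidMorphism.Build R R (hcomp 0) (hcomp0_1, hcomp0M).

Definition hcomp_mx i n (M : 'M[R]_n) : 'M[R]_n := map_mx (hcomp i) M.

Lemma nilpotent_hcomp0 n (N : 'M[R]_n) :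
  nilpotent_mx N -> nilpotent_mx (hcomp_mx 0 N).
Proof.
case=> m Nm0; exists m.
have <- : map_mx (hcomp 0) (N ^+ m) = hcomp_mx 0 N ^+ m.
  elim: m {Nm0} => [|m IH]; first exact: map_mx1.
  by rewrite !exprS -IH -!mulmxE map_mxM.
by rewrite Nm0 map_mx0.
Qed.

Fact degree0_subring : GRing.subring_closed (G 0).
Proof.
split=> [|x y xG yG|x y xG yG]; last exact: (gradingM xG yG).
  by rewrite -hcomp0_1 hcomp_in.
by rewrite rpredB.
Qed.

Record degree0 := Degree0 { degree0_val : R; _ : degree0_val \in G 0 }.
HB.instance Definition _ := [isSub for degree0_val].
HB.instance Definition _ := [Choice of degree0 by <:].

End Homogeneous.

HB.instance Definition _ (R : comPzRingType) (G : grading R) :=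
  GRing.SubChoice_isSubComPzRing.Build R (mem (G 0)) (degree0 G) (degree0_subring G).

Section CommutativeRings.
Variable A : comPzRingType.

Definition ideal (I : set A) : Prop :=
  [/\ I 0, forall x y, I x -> I y -> I (x + y) & forall a x, I x -> I (a * x)].

Definition maximal_ideal (I : set A) : Prop :=
  [/\ ideal I, I <> setT
    & forall J : set A, ideal J -> (I `<=` J)%classic -> J = I \/ J = setT].

Definition local_ring : Prop := exists! m : set A, maximal_ideal m.

Definition reduced_ring : Prop := forall (x : A) n, x ^+ n = 0 -> x = 0.

End CommutativeRings.

(* Main.v *)
Require Import Defs.
From HB Require Import structures.
From mathcomp Require Import all_boot all_order all_algebra.
From mathcomp Require Import mathcomp_extra boolp classical_sets.
From mathcomp Require Import mxtens ring.

Set Implicit Arguments.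
Unset Strict Implicit.
Unset Printing Implicit Defensive.

Import GRing.Theory.
Local Open Scope ring_scope.

(* Send x to sum_i x_i t^i in R[t]: this is hcomp 0 at t = 0 and the identity *)
(* at t = 1, so it suffices that a class [b] of K_1(R[t]) with                *)
(* b(0) = 1 and [b]^k = 1 has b(1) in E(R). By Higman's trick b is 1 - tN     *)
(* up to stabilisation and elementary factors, with N over R nilpotent. As k  *)
(* is invertible, some polynomial g over R has g(0) = 1 and g(N)^k = 1 - N.   *)
(* Higman's trick applied to the 1 x 1 matrix g(s) gives 1 - sC. Replacing t  *)
(* by the matrix C sends E(R[t]) to E(R), so (1 - N (x) C)^k is elementary;   *)
(* replacing s by N shows [1 - N (x) C] = [g(N)]. Hence [1 - N] = [g(N)]^k    *)
(* is trivial. In the local case [b(0)] lies in the image of SK_1(R_0) = 1.   *)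

(** * The group K_1 and its functoriality *)

(** The ring map [hpoly] deforms the identity of R (t = 1) into the projection to degree 0 (t = 0),
    so [K1_graded_torsion] follows from [K1_poly_torsion]: a k-torsion class over R[t] has equal
    values at t = 0 and t = 1. After division by the value at 0, [higman_linearisation] and
    [unipotent_poly_nilpotent] reduce this to classes [1 - tN] with N nilpotent. The kernel of t = 0
    on K_1(R[t]) is a module over the big Witt vectors of R, and since k is a unit the truncated
    root g of 1 - s acts there as 1/k. [K1_class_unipotent_eq1] makes this concrete: one matrix 1 -
    N (x) C is read both as 1 - tN at t = C, which shows that its class is k-torsion, and as 1 - sC
    at s = N, which shows that its class is [g(N)], a k-th root of [1 - N]. Membership in SK_1 is a
    separate point: det(1 + N) is 1 plus a nilpotent, and such an element is 1 once its k-th power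
    is ([det_unipotent_nilpotent], [nilpotent_torsion]). In the local case, the degree-0 class comes
    from SK_1(R_0), which elimination shows to be trivial ([SK1_local]). *)

Section K1Lemmas.
Variable A : comPzRingType.

Lemma K1_class_invE n (a : GL A n) : K1_class (GLinv a) = (K1_class a)^-1%g.
Proof. by rewrite -K1_invE. Qed.

Lemma K1_mulC (x y : K1 A) : (x * y = y * x)%g.
Proof.
have [n [a [b [_ [-> -> _]]]]] := K1_class_common x y 1%g.
rewrite -!K1_classM; apply/K1_classP; exists (n + n)%N.
rewrite /= !leq_addr; split=> //; pose c := GLmul b a.
(* With c = ba, this product of three Whitehead matrices is diag(c^-1 a b, 1). *)
exists (block_mx (GLinvmx c) 0 0 c *m block_mx a 0 0 (GLinvmx a) *m
        block_mx b 0 0 (GLinvmx b)).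
  do 2!(apply: elementaryM; last first;
    first by apply: elementary_whitehead; rewrite ?GLmulV ?GLmulVl).
  by apply: elementary_whitehead; rewrite ?GLmulV ?GLmulVl.
rewrite !stab_block !mulmx_block !(mulmx0, mul0mx, addr0, add0r, mul1mx, mulmx1).
rewrite -/c; congr block_mx.
  rewrite -(mulmxA (GLinvmx c)) (mulmxA (c : 'M_n) (GLinvmx c)).
  by rewrite (GLmulV c) mul1mx.
by rewrite [(c : 'M_n)]GL_mulE -(mulmxA (b : 'M_n)) GLmulV mulmx1 GLmulV.
Qed.

Lemma K1_class_elementary n (a : GL A n) :
  elementary a -> K1_class a = 1%g.
Proof.
move=> ea; rewrite -(K1_class_one A n); apply/K1_classP.
by exists n; split=> //; exists a => //; rewrite !stab_id mul1mx.
Qed.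

Lemma K1_class_eq1 n (a : GL A n) : K1_class a = 1%g ->
  exists2 p, (n <= p)%N & forall q, (p <= q)%N -> elementary (stab q a).
Proof.
rewrite -(K1_class_one A n) => /K1_classP/K1_rel_ge[p hp].
exists p => [|q /hp[/= _ _ [e ee ->]]]; first by have [] := hp p (leqnn p).
by rewrite stab1 mul1mx.
Qed.

Lemma elementary_GL n (e : 'M[A]_n) : elementary e ->
  exists a : GL A n, a = e :> 'M[A]_n.
Proof. by case/elementary_inv=> f [_ ef fe]; exists (mkGL ef fe). Qed.

Lemma K1_class_elementary_mul n p (np : (n <= p)%N) (a : GL A n) (e f m : 'M[A]_p) :
    elementary e -> elementary f -> e *m stab p a *m f = m ->
  exists2 b : GL A p, b = m :> 'M[A]_p & K1_class b = K1_class a.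
Proof.
move=> ee ef <-; have [[e' eE] [f' fE]] := (elementary_GL ee, elementary_GL ef).
exists (GLmul (GLmul e' (GLstab np a)) f'); first by rewrite !GLE eE fE.
rewrite !K1_classM K1_class_stab (@K1_class_elementary _ e') ?eE //.
by rewrite (@K1_class_elementary _ f') ?fE // mulg1 mul1g.
Qed.

Lemma GL_exp n (a : GL A n) k :
  exists2 b : GL A n, b = (a : 'M[A]_n) ^+ k :> 'M[A]_n &
    K1_class b = (K1_class a ^+ k)%g.
Proof.
elim: k => [|k [b bE cb]]; first by exists (GLone A n); rewrite ?K1_class_one.
by exists (GLmul a b); rewrite ?GLE ?bE ?exprS // K1_classM cb expgS.
Qed.

End K1Lemmas.

Section Functoriality.
Variables (A B : comPzRingType) (f : {rmorphism A -> B}).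

Lemma GLmap_subproof n (a : GL A n) :
  map_mx f a *m map_mx f (GLinvmx a) = 1%:M /\
  map_mx f (GLinvmx a) *m map_mx f a = 1%:M.
Proof. by rewrite -!map_mxM GLmulV GLmulVl map_mx1. Qed.

Definition GLmap n (a : GL A n) : GL B n :=
  mkGL (GLmap_subproof a).1 (GLmap_subproof a).2.

Lemma GLmapE n (a : GL A n) : GLmap a = map_mx f a :> 'M[B]_n.
Proof. by []. Qed.

Lemma elementary_map n (M : 'M[A]_n) : elementary M -> elementary (map_mx f M).
Proof.
elim=> [|i j x N ij _ IH]; first by rewrite map_mx1; left.
rewrite map_mxM map_mxD map_mx1 map_mxZ map_delta_mx; exact: elementary_consl.
Qed.

Lemma map_stab n p (M : 'M[A]_n) : map_mx f (stab p M) = stab p (map_mx f M).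
Proof.
apply/matrixP=> i j; rewrite !mxE /stab_entry.
case: insub => [?|]; last by rewrite rmorph_nat.
by case: insub => [?|]; rewrite ?rmorph_nat ?mxE.
Qed.

Lemma K1_class_map n m (a : GL A n) (b : GL A m) :
  K1_class a = K1_class b -> K1_class (GLmap a) = K1_class (GLmap b).
Proof.
move=> /K1_classP[p [np mp [e ee eab]]]; apply/K1_classP; exists p; split=> //=.
exists (map_mx f e); first exact: elementary_map.
by rewrite -!map_stab eab map_mxM.
Qed.

Lemma K1_class_map1 n (a : GL A n) :
  K1_class a = 1%g -> K1_class (GLmap a) = 1%g.
Proof.
rewrite -(K1_class_one A n) => /K1_class_map->; rewrite -(K1_class_one B n).
by apply: K1_class_eq; rewrite GLmapE !GLE map_mx1.
Qed.

Lemma K1_class_map_exp n (a : GL A n) k :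
  (K1_class a ^+ k = 1)%g -> (K1_class (GLmap a) ^+ k = 1)%g.
Proof.
have [b bE <-] := GL_exp a k; have [c cE <-] := GL_exp (GLmap a) k.
move=> /K1_class_map1 <-; apply: K1_class_eq; rewrite cE !GLmapE bE.
elim: k {b bE c cE} => [|k IH]; first by rewrite !expr0 map_mx1.
by rewrite !exprS -!mulmxE map_mxM IH.
Qed.

End Functoriality.

(** * Substituting matrices for the variable *)

(* A ring homomorphism S -> M_q(R) turns an n x n matrix over S into an n x n *)
(* matrix of q x q blocks. The rows of the result may be enumerated in any    *)
(* order u: comparing two substitutions requires the two lexicographic orders *)
(* on pairs of indices.                                                       *)
Section Transfer.
Variables (S R : comPzRingType) (q : nat) (f : {rmorphism S -> 'M[R]_q}).
Variables (n r : nat) (u : 'I_r -> 'I_n * 'I_q) (v : 'I_n * 'I_q -> 'I_r).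
Hypotheses (uK : cancel u v) (vK : cancel v u).

Definition transfer (M : 'M[S]_n) : 'M[R]_r :=
  \matrix_(k, l) f (M (u k).1 (u l).1) (u k).2 (u l).2.

Lemma transferM (M N : 'M[S]_n) :
  transfer (M *m N) = transfer M *m transfer N.
Proof.
apply/matrixP=> k l; rewrite [LHS]mxE [RHS]mxE mxE raddf_sum /= summxE.
rewrite [RHS](reindex v) /=; last by exists u => i _; rewrite ?uK ?vK.
transitivity (\sum_i \sum_j transfer M k (v (i, j)) * transfer N (v (i, j)) l).
  apply: eq_bigr => i _; rewrite rmorphM /= -mulmxE mxE.
  by apply: eq_bigr => j _; rewrite !mxE vK.
by rewrite pair_bigA; apply: eq_bigr => -[].
Qed.

Lemma transferD (M N : 'M[S]_n) :
  transfer (M + N) = transfer M + transfer N.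
Proof. by apply/matrixP=> k l; rewrite !mxE rmorphD /= mxE. Qed.

Lemma transfer1 : transfer 1%:M = 1%:M.
Proof.
apply/matrixP=> k l; rewrite !mxE -(can_eq uK k l) -pair_eqE /pair_eq /=.
by case: ((u k).1 =P (u l).1) => _; rewrite ?rmorph1 ?rmorph0 /= mxE.
Qed.

Lemma transferX (M : 'M[S]_n) k : transfer (M ^+ k) = transfer M ^+ k.
Proof.
elim: k => [|k IH]; first by rewrite !expr0 transfer1.
by rewrite !exprS -!mulmxE transferM IH.
Qed.

(* An off-diagonal block Y is the sum of its entries, and these add up in     *)
(* products of the corresponding block transvections.                         *)
Lemma elementary_transfer (M : 'M[S]_n) : elementary M -> elementary (transfer M).
Proof.
elim=> [|i j x N ij _ IH]; first by rewrite transfer1; left.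
rewrite transferM; apply: elementaryM => //.
pose F (Y : 'M[R]_q) : 'M[R]_r := 1%:M + \matrix_(k, l)
  (if ((u k).1 == i) && ((u l).1 == j) then Y (u k).2 (u l).2 else 0).
have -> : transfer (1%:M + x *: delta_mx i j) = F (f x).
  rewrite transferD transfer1; congr (_ + _); apply/matrixP=> k l; rewrite !mxE.
  by case: ifP; rewrite ?mulr1 ?mulr0 ?rmorph0 //= mxE.
have F0 : F 0 = 1%:M.
  rewrite /F -[RHS]addr0; congr (_ + _); apply/matrixP=> k l.
  by rewrite !mxE; case: ifP.
have FD Y Z : F (Y + Z) = F Y *m F Z.
  rewrite /F mulmxDl mul1mx mulmxDr mulmx1 [X in _ + (_ + X)](_ : _ = 0).
    rewrite addr0 -addrA [X in _ = _ + X]addrC; congr (_ + _).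
    by apply/matrixP=> k l; rewrite !mxE; case: ifP; rewrite ?addr0.
  apply/matrixP=> k l; rewrite !mxE big1 // => h _; rewrite !mxE.
  case: andP => [[_ /eqP->]|_]; last by rewrite mul0r.
  by rewrite eq_sym (negPf ij) mulr0.
rewrite [f x]matrix_sum_delta.
elim/big_ind: _ => [|Y Z|a _]; first by rewrite F0; left.
  by rewrite FD; apply: elementaryM.
elim/big_ind: _ => [|Y Z|b _]; first by rewrite F0; left.
  by rewrite FD; apply: elementaryM.
rewrite (_ : F _ = 1%:M + f x a b *: delta_mx (v (i, a)) (v (j, b))).
  by apply: elementary_gen; rewrite (can_eq vK) xpair_eqE (negPf ij).
rewrite /F; congr (_ + _); apply/matrixP=> k l; rewrite !mxE.
rewrite -(can_eq uK k) -(can_eq uK l) !vK -!pair_eqE /pair_eq /=.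
by case: (_ == i) => /=; case: (_ == j); rewrite ?andbF ?andbT ?mulr0.
Qed.

End Transfer.

(** * Higman linearisation and torsion in K_1 of polynomial rings *)

Section Linearisation.
Variable R : comNzRingType.

(** For n <= p the matrix [1%:M - stab p (1%:M - N)] is diag(N, 0), so stabilising keeps the shape 1
    - XN. *)
Lemma stab_map_polyC n p (N : 'M[R]_n) :
  stab p (1%:M - 'X *: map_mx polyC N) =
  1%:M - 'X *: map_mx polyC (1%:M - stab p (1%:M - N)) :> 'M[{poly R}]_p.
Proof.
apply/matrixP=> i j; rewrite !mxE /stab_entry.
case: insubP => [i' _ ei|_]; last first.
  by rewrite -!val_eqE polyCB subrr mulr0 subr0.
case: insubP => [j' _ ej|_]; last by rewrite -!val_eqE polyCB subrr mulr0 subr0.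
by rewrite !mxE -!val_eqE /= ei ej subKr.
Qed.

Lemma matrix_poly_linear n (M : 'M[{poly R}]_n) :
    (forall i j, (M i j)`_0 = (i == j)%:R) -> (forall i j, (size (M i j) <= 2)%N) ->
  M = 1%:M - 'X *: map_mx polyC (\matrix_(i, j) - (M i j)`_1).
Proof.
move=> M0 sM; apply/matrixP=> i j; rewrite !mxE; apply/polyP=> -[|[|l]].
- by rewrite coefB coefXM /= subr0 -polyC_natr coefC M0.
- by rewrite coefB coefXM coefC /= -polyC_natr coefC /= sub0r opprK.
- rewrite coefB coefXM coefC /= -polyC_natr coefC /= subr0.
  by rewrite nth_default // (leq_trans (sM i j)).
Qed.

(** One block row operation and one block column operation separate the factors of the product xy,
    which lowers the degree. *)
Lemma block_mx_descent n (A B : 'M[{poly R}]_n) (x y : {poly R}) :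
  block_mx 1%:M (x *: B) 0 1%:M *m stab (n + n) (A + (x * y) *: B) *m
    block_mx 1%:M 0 (- y)%:M 1%:M =
  block_mx A (x *: B) (- y)%:M 1%:M.
Proof.
rewrite stab_block !mulmx_block !(mulmx0, mul0mx, mulmx1, mul1mx, addr0, add0r).
congr block_mx; rewrite mul_mx_scalar scalerA mulNr scaleNr (mulrC y) addrK //.
Qed.

(* Higman's trick: a coefficient B of degree d + 2 is moved to degrees 1 and  *)
(* d + 1 of a matrix of twice the size.                                       *)
Lemma higman_linearisation d n (M : 'M[{poly R}]_n.+1) :
    (forall i j, (M i j)`_0 = (i == j)%:R) ->
    (forall i j, (size (M i j) <= d.+2)%N) ->
  exists q (N : 'M[R]_q.+1) (e f : 'M[{poly R}]_q.+1),
    [/\ (n <= q)%N, elementary e, elementary f &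
        e *m stab q.+1 M *m f = 1%:M - 'X *: map_mx polyC N].
Proof.
elim: d n M => [|d IH] n M M0 sM.
  exists n, (\matrix_(i, j) - (M i j)`_1), 1%:M, 1%:M.
  split=> //; try by left.
  by rewrite stab_id mul1mx mulmx1 -matrix_poly_linear.
pose B := map_mx (fun p : {poly R} => (p`_d.+2)%:P) M.
pose A := M - ('X * 'X^(d.+1)) *: B.
have eM : M = A + ('X * 'X^(d.+1)) *: B by rewrite subrK.
have eA i j : A i j = M i j - ((M i j)`_d.+2)%:P * 'X^(d.+2).
  by rewrite !mxE -exprS mulrC.
pose M' : 'M_(n.+1 + n.+1) := block_mx A ('X *: B) (- 'X^(d.+1))%:M 1%:M.
have M'0 (i j : 'I_(n.+1 + n.+1)) : (M' i j)`_0 = (i == j)%:R.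
  rewrite /M'.
  case: (split_ordP i) => i' ->; case: (split_ordP j) => j' ->;
    rewrite !(block_mxEul, block_mxEur, block_mxEdl, block_mxEdr).
  - by rewrite eA coefB coefMXn /= subr0 M0 eq_lshift.
  - by rewrite !mxE coefXM eq_lrshift.
  - by rewrite !mxE eq_rlshift coefMn coefN coefXn /= oppr0 mul0rn.
  - by rewrite !mxE eq_rshift -polyC_natr coefC.
have sM' (i j : 'I_(n.+1 + n.+1)) : (size (M' i j) <= d.+2)%N.
  rewrite /M'.
  case: (split_ordP i) => i' ->; case: (split_ordP j) => j' ->;
    rewrite !(block_mxEul, block_mxEur, block_mxEdl, block_mxEdr).
  - apply/leq_sizeP => l; rewrite eA coefB coefCM coefXn leq_eqVlt => /orP[/eqP<-|dl].
      by rewrite eqxx mulr1 subrr.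
    rewrite [in (_ == _)]gtn_eqF // mulr0 subr0 nth_default //.
    exact: leq_trans (sM _ _) dl.
  - rewrite !mxE mulrC (leq_trans (size_polyMleq _ _)) // size_polyX addn2 /=.
    by rewrite (leq_ltn_trans (size_polyC_leq1 _)).
  - rewrite !mxE; case: eqP; rewrite ?mulr0n ?mulr1n ?size_poly0 //.
    by rewrite size_polyN size_polyXn.
  - by rewrite !mxE -polyC_natr (leq_trans (size_polyC_leq1 _)).
have [q [N [e [f [nq ee ef eN]]]]] := IH (n + n.+1)%N M' M'0 sM'.
exists q, N, (e *m stab q.+1 (block_mx 1%:M ('X *: B) 0 1%:M : 'M_(n.+1 + n.+1))),
  (stab q.+1 (block_mx 1%:M 0 (- 'X^(d.+1))%:M 1%:M : 'M_(n.+1 + n.+1)) *m f).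
have nnq : (n.+1 + n.+1 <= q.+1)%N by [].
split.
- by apply: leq_trans (leq_trans nq (leqnn q)); rewrite leq_addr.
- by apply: elementaryM => //; apply: elementary_stab => //; apply: elementary_ublock.
- by apply: elementaryM => //; apply: elementary_stab => //; apply: elementary_lblock.
rewrite -eN /M' -block_mx_descent -eM !stabM // stab_stab ?leq_addr //.
by rewrite !mulmxA.
Qed.

End Linearisation.

(** * Truncated roots and the two substitutions into 1 - XN *)

Section PolynomialTorsion.
Variable R : comNzRingType.

Lemma exprD_linear_part (A : comNzRingType) (x y : A) k :
  exists w, (x + y) ^+ k.+1 = x ^+ k.+1 + k.+1%:R * x ^+ k * y + y ^+ 2 * w.
Proof.
elim: k => [|k [w IH]]; first by exists 0; rewrite !expr1 expr0; ring.
exists (k.+1%:R * x ^+ k + (x + y) * w).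
by rewrite exprS IH !exprS -[k.+2%:R]natr1; ring.
Qed.

Lemma poly_split0 (p : {poly R}) : exists q, p = (p`_0)%:P + 'X * q.
Proof.
exists (\poly_(i < size p) p`_i.+1); apply/polyP=> i.
rewrite coefD coefC coefXM coef_poly; case: i => [|i] /=; first by rewrite addr0.
by rewrite add0r; case: ltnP => // si; rewrite nth_default // ltnW.
Qed.

Lemma poly_coef0_expr (p : {poly R}) k : p`_0 = 1 -> exists h, p ^+ k = 1 + 'X * h.
Proof.
move=> p0; elim: k => [|k [h IH]]; first by exists 0; rewrite expr0 mulr0 addr0.
have [g gE] := poly_split0 p; rewrite p0 in gE.
by exists (g + h + 'X * g * h); rewrite exprS IH {1}gE; ring.
Qed.

(** The binomial series of (1 - X)^(1/k), built one coefficient at a time as in Hensel's lemma.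
    Truncation suffices because g is evaluated at a nilpotent matrix. *)
Lemma poly_root_truncated k (u : R) m : u * k%:R = 1 ->
  exists g h : {poly R}, g`_0 = 1 /\ g ^+ k = 1 - 'X + 'X^(m.+1) * h.
Proof.
case: k => [|k] uk; first by move/eqP: uk; rewrite mulr0 eq_sym oner_eq0.
elim: m => [|m [g [h [g0 gk]]]].
  by exists 1, 1; rewrite coef1 expr1n; split=> //; ring.
(* The linear term of (g + y)^(k+1) is (k+1) g^k y. Since g has constant term 1, this choice of y
   cancels the error term in degree m + 1. *)
pose y : {poly R} := - ((u * h`_0)%:P * 'X^(m.+1)).
have [w wE] := exprD_linear_part g y k.
have [g2 g2E] := poly_coef0_expr k g0.
have [h1 hE] := poly_split0 h.
have ukP : u%:P * k.+1%:R = 1 :> {poly R} by rewrite -polyC_natr -polyCM uk.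
exists (g + y), (h1 - (h`_0)%:P * g2 + u%:P ^+ 2 * (h`_0)%:P ^+ 2 * 'X^m * w).
split; first by rewrite coefD g0 coefN coefCM coefXn /= mulr0 oppr0 addr0.
rewrite wE gk g2E {1}hE /y polyCM.
have -> : k.+1%:R * (1 + 'X * g2) * - (u%:P * (h`_0)%:P * 'X^(m.+1)) =
  - ((u%:P * k.+1%:R) * (1 + 'X * g2) * (h`_0)%:P * 'X^(m.+1)) by ring.
by rewrite ukP !exprS; ring.
Qed.

(** The inverse must be the geometric series in XN. Its coefficients N^i vanish eventually, as the
    entries of B are polynomials. *)
Lemma unipotent_poly_nilpotent n (N : 'M[R]_n) (B : 'M[{poly R}]_n) :
  (1%:M - 'X *: map_mx polyC N) *m B = 1%:M -> exists m, N ^+ m = 0.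
Proof.
move=> NB; pose c i : 'M[R]_n := map_mx (coefp i) B.
have BE : B = 1%:M + 'X *: (map_mx polyC N *m B).
  by rewrite -NB mulmxBl mul1mx -scalemxAl subrK.
have c0 : c 0%N = 1%:M.
  apply/matrixP=> i j; rewrite !mxE [in B i j]BE !mxE /coefp coefD coefXM addr0.
  by rewrite -polyC_natr coefC.
have cS i : c i.+1 = N *m c i.
  apply/matrixP=> a b; rewrite !mxE [in B a b]BE !mxE /coefp coefD coefXM /=.
  rewrite -polyC_natr coefC /= add0r coef_sum; apply: eq_bigr => j _.
  by rewrite !mxE coefCM.
have cN i : c i = N ^+ i.
  by elim: i => [|i IH]; [rewrite c0|rewrite cS IH exprS].
exists (\max_i \max_j size (B i j)); rewrite -cN; apply/matrixP=> i j.
rewrite !mxE /= nth_default //.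
by apply: leq_trans (leq_bigmax i); apply: (leq_bigmax j).
Qed.

(** Both substitutions yield 1 - N (x) C; swapping the index pairs on the left aligns the orders of
    rows and columns. *)
Lemma transfer_swap p q (N : 'M[R]_p.+1) (C : 'M[R]_q.+1) :
  transfer (horner_mx C) (fun k : 'I_(q.+1 * p.+1) => (swap_pair (mxtens_unindex k)))
    (1%:M - 'X *: map_mx polyC N) =
  transfer (horner_mx N) (fun k : 'I_(q.+1 * p.+1) => mxtens_unindex k)
    (1%:M - 'X *: map_mx polyC C).
Proof.
have h n (A : 'M[R]_n.+1) (b : bool) (x : R) i j :
    horner_mx A (b%:R - 'X * x%:P) i j = (b && (i == j))%:R - x * A i j.
  rewrite rmorphB rmorphM /= horner_mx_X horner_mx_C rmorph_nat.
  rewrite -mulmxE mul_mx_scalar !mxE.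
  by case: b => /=; rewrite !mxE.
apply/matrixP=> k l; rewrite !mxE !h /=.
by rewrite [_ && _]andbC [_ * C _ _]mulrC.
Qed.

(** In lexicographic order the first p + 1 indices form the first block, so diag(g, 1) becomes
    diag(g(N), 1). *)
Lemma transfer_stab p q (N : 'M[R]_p.+1) (g : {poly R}) :
  transfer (horner_mx N) (fun k : 'I_(q.+1 * p.+1) => mxtens_unindex k)
    (stab q.+1 (g%:M : 'M_1)) = stab (q.+1 * p.+1) (horner_mx N g).
Proof.
have hb (b : bool) i j : horner_mx N b%:R i j = (b && (i == j))%:R.
  by rewrite rmorph_nat; case: b; rewrite ?mxE.
have eqdm (k l : nat) :
    (k %/ p.+1 == l %/ p.+1)%N && (k %% p.+1 == l %% p.+1)%N = (k == l).
  apply/andP/eqP=> [[/eqP kd /eqP km]|->//].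
  by rewrite (divn_eq k p.+1) (divn_eq l p.+1) kd km.
apply/matrixP=> k l; rewrite !mxE /=.
case: (ltnP k p.+1) => kp; last first.
  have kp1 : (1 <= k %/ p.+1)%N by rewrite divn_gt0.
  by rewrite !stab_entryl // hb -val_eqE eqdm.
case: (ltnP l p.+1) => lp; last first.
  have lp1 : (1 <= l %/ p.+1)%N by rewrite divn_gt0.
  by rewrite !stab_entryr // hb -val_eqE eqdm.
rewrite !divn_small // (stab_entry_ord _ (Ordinal kp) (Ordinal lp)).
rewrite (stab_entry_ord _ (ord0 : 'I_1) (ord0 : 'I_1)) mxE mulr1n.
by congr (horner_mx N g _ _); apply: val_inj; rewrite /= modn_small.
Qed.
End PolynomialTorsion.

(** * Torsion in the kernel of K_1(R[t]) -> K_1(R) *)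

Section NK1.
Variables (R : comNzRingType) (k : nat) (u : R).
Hypothesis uk : u * k%:R = 1.

Lemma K1_class_unipotent_eq1 p (N : 'M[R]_p.+1) m (c : GL R p.+1) :
    N ^+ m = 0 -> c = 1%:M - N :> 'M[R]_p.+1 ->
    elementary ((1%:M - 'X *: map_mx polyC N) ^+ k) ->
  K1_class c = 1%g.
Proof.
move=> Nm cE eN.
have [g [h [g0 gk]]] := poly_root_truncated m uk.
have k_gt0 : (0 < k)%N.
  rewrite lt0n; apply/eqP => k0; move: uk; rewrite k0 mulr0 => /esym/eqP.
  by rewrite oner_eq0.
pose gN := horner_mx N g.
have gNk : gN ^+ k = c.
  rewrite -rmorphXn gk rmorphD rmorphB rmorphM /= rmorphXn /= rmorph1 horner_mx_X.
  by rewrite exprS Nm mulr0 mul0r addr0 cE.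
(* g(N) is invertible because its k-th power c is; this uses k > 0. *)
have gNV : gN *m (gN ^+ k.-1 *m GLinvmx c) = 1%:M.
  by rewrite mulmxA mulmxE -exprS prednK // gNk -mulmxE GLmulV.
pose G := mkGL gNV (mulmx1C gNV).
have [||q [C [e [f [_ ee ef eC]]]]] :=
  @higman_linearisation _ (size g) 0%N (g%:M : 'M_1).
- by move=> i j; rewrite !ord1 mxE eqxx.
- by move=> i j; rewrite !ord1 mxE eqxx mulr1n -addn2 leq_addr.
pose iK := @mxtens_indexK q.+1 p.+1; pose uK := @mxtens_unindexK q.+1 p.+1.
pose r := (q.+1 * p.+1)%N.
pose TN := @transfer _ _ _ (horner_mx N) _ r (fun l => mxtens_unindex l).
have TNM := @transferM _ _ _ (horner_mx N) _ r _ _ uK iK.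
have TNe := @elementary_transfer _ _ _ (horner_mx N) _ r _ _ uK iK.
(* First reading of 1 - N (x) C: substituting N in the linearisation of g gives the class of
   g(N). *)
have [b bE bG] : exists2 b : GL R r, b = TN (1%:M - 'X *: map_mx polyC C) :> 'M_r &
    K1_class b = K1_class G.
  apply: (@K1_class_elementary_mul _ _ _ _ _ (TN e) (TN f)); rewrite ?leq_pmull //.
  - exact: TNe.
  - exact: TNe.
  by rewrite -eC /TN !TNM -transfer_stab.
(* Second reading: substituting C for X in the elementary matrix (1 - XN)^k. *)
have bk : (K1_class b ^+ k = 1)%g.
  have [b' b'E <-] := GL_exp b k; apply: K1_class_elementary.
  pose v ij : 'I_r := mxtens_index (swap_pair ij).
  pose w (l : 'I_r) := swap_pair (mxtens_unindex l).
  have wK : cancel w v by move=> l; rewrite /v swap_pairK; apply: uK.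
  have vK : cancel v w by move=> ij; rewrite /w iK swap_pairK.
  rewrite b'E bE /TN -transfer_swap -(transferX _ wK vK).
  exact: (elementary_transfer _ wK vK).
have [G' G'E cG'] := GL_exp G k.
by rewrite -bk bG -cG'; apply: K1_class_eq; rewrite G'E -gNk.
Qed.

Lemma K1_poly_torsion1 n (b : GL {poly R} n) :
    (forall i j, (b i j)`_0 = (i == j)%:R) -> (K1_class b ^+ k = 1)%g ->
  K1_class (GLmap (horner_eval 1) b) = 1%g.
Proof.
move=> b0 bk; pose b1 := GLstab (leqnSn n) b.
have b1E : K1_class b1 = K1_class b by apply: K1_class_stab.
have [||q [N [e [f [nq ee ef eN]]]]] :=
  @higman_linearisation _ (\max_i \max_j size (b1 i j)) n b1.
- move=> i j; rewrite mxE /stab_entry; case: insubP => [i' _ ei|_].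
    case: insubP => [j' _ ej|_]; first by rewrite b0 -!val_eqE /= ei ej.
    by rewrite -polyC_natr coefC.
  by rewrite -polyC_natr coefC.
- move=> i j; rewrite 2?leqW //.
  by apply: leq_trans (leq_bigmax i); apply: (leq_bigmax j).
have [d dE db] := K1_class_elementary_mul (nq : n.+1 <= q.+1)%N ee ef eN.
have [dk dkE cdk] := GL_exp d k.
have [p qp ep] : exists2 p, (q.+1 <= p)%N &
    forall r, (p <= r)%N -> elementary (stab r dk).
  by apply: K1_class_eq1; rewrite cdk db b1E.
(* Evaluating polynomials at a matrix requires a nonzero size. *)
case: p qp ep => // p qp /(_ _ (leqnn _)).
pose N' : 'M[R]_p.+1 := 1%:M - stab p.+1 (1%:M - N).
have sd : stab p.+1 d = 1%:M - 'X *: map_mx polyC N' by rewrite dE stab_map_polyC.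
have -> : stab p.+1 dk = (1%:M - 'X *: map_mx polyC N') ^+ k.
  rewrite -sd dkE; elim: (k) => [|l IH]; first by rewrite !expr0 stab1.
  by rewrite !exprS -!mulmxE stabM // IH.
move=> eN'; pose d' := GLstab qp d.
have [m N'm] : exists m, N' ^+ m = 0.
  apply: (@unipotent_poly_nilpotent _ _ _ (GLinvmx d')).
  by rewrite -sd; apply: (GLmulV d').
have d'1 : K1_class d' = K1_class b by rewrite K1_class_stab db.
rewrite -(K1_class_map _ d'1); apply: K1_class_unipotent_eq1 N'm _ eN'.
rewrite GLmapE [(d' : 'M_ _)]sd; apply/matrixP=> i j.
by rewrite !mxE /= /horner_eval !hornerE -polyC_natr hornerC.
Qed.

Lemma K1_poly_torsion n (g : GL {poly R} n) : (K1_class g ^+ k = 1)%g ->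
  K1_class (GLmap (horner_eval 1) g) = K1_class (GLmap (horner_eval 0) g).
Proof.
move=> gk; pose g0 := GLmap (polyC : {rmorphism R -> {poly R}}) (GLmap (horner_eval 0) g).
(* Dividing by the constant matrix g(0) gives value 1 at 0; b remains k-torsion because K_1 is
   abelian. *)
pose b := GLmul g (GLinv g0).
have bk : (K1_class b ^+ k = 1)%g.
  rewrite K1_classM K1_class_invE expgMn; last exact: K1_mulC.
  by rewrite gk mul1g expVgn !K1_class_map_exp // invg1.
have mapK : map_mx (horner_eval 0) g0 = map_mx (horner_eval 0) g.
  by apply/matrixP=> i j; rewrite !mxE /= /horner_eval hornerC.
have b0 i j : (b i j)`_0 = (i == j)%:R.
  suff /matrixP/(_ i j) : map_mx (horner_eval 0) b = 1%:M.
    by rewrite !mxE /= /horner_eval horner_coef0.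
  by rewrite GL_mulE map_mxM -mapK -map_mxM /= GLmulV map_mx1.
have := K1_poly_torsion1 b0 bk.
have -> : K1_class (GLmap (horner_eval 1) b) =
    (K1_class (GLmap (horner_eval 1) g) * (K1_class (GLmap (horner_eval 0) g))^-1)%g.
  rewrite -K1_class_invE -K1_classM; apply: K1_class_eq.
  rewrite !GLE !GLmapE GL_mulE map_mxM; congr (_ *m _).
  pose V := map_mx (horner_eval (0 : R)) (GLinvmx g).
  rewrite -[LHS]/(map_mx (horner_eval 1) (map_mx polyC V)) -[RHS]/V.
  by apply/matrixP=> i j; rewrite mxE mxE /= /horner_eval hornerC.
by move/(canRL (mulgK _)); rewrite invgK mul1g.
Qed.

End NK1.

(** * Graded rings *)

Section GradedTorsion.
Variables (R : comNzRingType) (G : grading R).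

Lemma hpoly_exists x : exists p : {poly R}, forall i, p`_i = hcomp G i x.
Proof.
have [_ [d [xd _]]] := hcompP G x.
exists (\poly_(i < d) hcomp G i x) => i; rewrite coef_poly.
by case: ltnP => // /xd->.
Qed.

Definition hpoly x : {poly R} := sval (cid (hpoly_exists x)).

Lemma coef_hpoly x i : (hpoly x)`_i = hcomp G i x.
Proof. exact: svalP (cid (hpoly_exists x)) i. Qed.

Lemma hpoly_is_zmod_morphism : zmod_morphism hpoly.
Proof. by move=> x y; apply/polyP=> i; rewrite coefB !coef_hpoly raddfB. Qed.

Lemma hpoly_is_monoid_morphism : monoid_morphism hpoly.
Proof.
split=> [|x y]; apply/polyP=> i.
  rewrite coef_hpoly (@hcomp_hom _ _ i 0%N 1) ?coef1; first by case: i.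
  by have [_] := degree0_subring G; rewrite -(hcomp0_1 G) hcomp_in.
rewrite coefM coef_hpoly; under [RHS]eq_bigr do rewrite !coef_hpoly.
have [hx [d [xd xE]]] := hcompP G x.
(* The range is widened to contain every j <= i; the terms with j > i contribute nothing in degree
   i. *)
have {}xE : x = \sum_(j < maxn d i.+1) hcomp G j x.
  by rewrite {1}xE (decomposition_widen (leq_maxl d i.+1)).
rewrite {1}xE mulr_suml raddf_sum /=.
under eq_bigr => j _ do rewrite (hcomp_homM i y (hx j)).
rewrite (big_ord_widen _ (fun j => hcomp G j x * hcomp G (i - j) y) (leq_maxr d i.+1)).
by rewrite [RHS]big_mkcond.
Qed.

HB.instance Definition _ :=
  GRing.isZmodMorphism.Build R {poly R} hpoly hpoly_is_zmod_morphism.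
HB.instance Definition _ :=
  GRing.isMonoidMorphism.Build R {poly R} hpoly hpoly_is_monoid_morphism.

Lemma hpoly_eval0 x : horner_eval 0 (hpoly x) = hcomp G 0 x.
Proof. by rewrite /horner_eval horner_coef0 coef_hpoly. Qed.

Lemma hpoly_eval1 x : horner_eval 1 (hpoly x) = x.
Proof.
rewrite /horner_eval horner_coef.
under eq_bigr do rewrite expr1n mulr1 coef_hpoly.
have [_ [d [xd xE]]] := hcompP G x.
rewrite [RHS]xE.
rewrite -(decomposition_widen (c := fun i => hcomp G i x)
  (leq_maxl (size (hpoly x)) d)) => [|i si]; last first.
  by rewrite -coef_hpoly nth_default.
by rewrite (decomposition_widen (leq_maxr (size (hpoly x)) d)).
Qed.

Lemma K1_graded_torsion k (u : R) n (a : GL R n) : u * k%:R = 1 ->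
    (K1_class a ^+ k = 1)%g ->
  K1_class a = K1_class (GLmap (hcomp G 0) a).
Proof.
move=> uk ak; have := K1_poly_torsion uk (K1_class_map_exp hpoly ak).
move=> e; transitivity (K1_class (GLmap (horner_eval 1) (GLmap hpoly a))).
  by apply: K1_class_eq; apply/matrixP=> i j; rewrite !mxE /= hpoly_eval1.
by rewrite e; apply: K1_class_eq; apply/matrixP=> i j; rewrite !mxE /= hpoly_eval0.
Qed.

End GradedTorsion.

(** * Determinants of unipotent matrices *)

Section UnipotentDeterminant.
Variable R : comNzRingType.

Definition nilpotent (x : R) : Prop := exists m, x ^+ m = 0.

Lemma nilpotentD (x y : R) : nilpotent x -> nilpotent y -> nilpotent (x + y).
Proof.
have exp0 (z : R) i j : z ^+ i = 0 -> (i <= j)%N -> z ^+ j = 0.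
  by move=> zi /subnK<-; rewrite exprD zi mulr0.
move=> [i xi] [j yj]; exists (i + j)%N; rewrite exprDn big1 // => l _.
case: (leqP j l) => [jl|lj]; first by rewrite (exp0 y j) // mulr0 mul0rn.
rewrite (exp0 x i) ?mul0r ?mul0rn //.
by rewrite -addnBA ?leq_addr // ltnW.
Qed.

(** The top coefficient of pq vanishes, so multiplying q by the coefficient of p in degree n + 1
    lowers the size of q. The constant c is general because it absorbs that factor in the
    induction. *)
Lemma lead_coef_poly_inverse n m (p q : {poly R}) c :
    (size p <= n.+2)%N -> (size q <= m)%N -> p * q = c%:P ->
  p`_n.+1 ^+ m * c = 0.
Proof.
move=> sp; elim: m q c => [|m IH] q c sq pq.
  move: sq pq; rewrite leqn0 size_poly_eq0 => /eqP->.
  by rewrite mulr0 => /esym/eqP; rewrite polyC_eq0 => /eqP->; rewrite mulr0.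
have aq : p`_n.+1 * q`_m = 0.
  have <- : (p * q)`_(n.+1 + m) = p`_n.+1 * q`_m; last by rewrite pq coefC.
  rewrite coefM; have lt_n : (n.+1 < (n.+1 + m).+1)%N by rewrite ltnS leq_addr.
  rewrite (bigD1 (Ordinal lt_n)) //= addKn big1 ?addr0 // => i.
  rewrite -val_eqE /= neq_ltn => /orP[i_lt|i_gt]; last first.
    by rewrite nth_default ?mul0r // (leq_trans sp).
  rewrite mulrC nth_default ?mul0r // (leq_trans sq) //.
  by rewrite ltn_subRL ltn_add2r.
rewrite exprSr -mulrA; apply: IH (p`_n.+1 *: q) _ _ _.
  apply/leq_sizeP => i; rewrite coefZ leq_eqVlt => /orP[/eqP<-//|mi].
  by rewrite [q`_i]nth_default ?mulr0 // (leq_trans sq).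
by rewrite -scalerAr pq -mul_polyC polyCM.
Qed.

(** The nonconstant coefficients of a unit polynomial are nilpotent. Once the top term is removed,
    the product with q is 1 - y with y nilpotent, so the rest is again a unit. *)
Lemma poly_unit_eval1_nilpotent n (p q : {poly R}) :
  (size p <= n.+1)%N -> p * q = 1 -> nilpotent (p.[1] - p`_0).
Proof.
elim: n p q => [|n IH] p q sp pq.
  by rewrite (size1_polyC sp) hornerC coefC subrr; exists 1%N; rewrite expr1.
pose a := p`_n.+1; pose m := size q.
have am : a ^+ m = 0.
  by rewrite -[LHS]mulr1; apply: (@lead_coef_poly_inverse n m p q 1).
pose y := a%:P * 'X^(n.+1) * q.
have ym : y ^+ m = 0 by rewrite !exprMn -polyC_exp am !mul0r.
have -> : p.[1] - p`_0 = ((p - a%:P * 'X^(n.+1)).[1] - (p - a%:P * 'X^(n.+1))`_0) + a.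
  rewrite !hornerE expr1n mulr1 coefB coefCM coefXn /= mulr0 subr0.
  by rewrite addrAC subrK.
apply: nilpotentD; last by exists m.
apply: (IH _ (q * \sum_(i < m) y ^+ i)).
  apply/leq_sizeP => i; rewrite coefB coefCM coefXn leq_eqVlt => /orP[/eqP<-|ni].
    by rewrite eqxx mulr1 subrr.
  by rewrite gtn_eqF // mulr0 subr0 nth_default // (leq_trans sp).
rewrite mulrA mulrBl pq -/y; apply: oppr_inj.
by rewrite -mulNr opprB -subrX1 ym sub0r.
Qed.

(** det(1 + XN) is a unit of R[X], with value 1 at 0 and det(1 + N) at 1. *)
Lemma det_unipotent_nilpotent n (N : 'M[R]_n) :
  nilpotent_mx N -> nilpotent (\det (1 + N) - 1).
Proof.
case=> m Nm; pose XN : 'M[{poly R}]_n := 'X *: map_mx polyC N.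
have [a aE] : exists a : GL {poly R} n, a = 1 + XN :> 'M_n.
  apply: nilpotent_GL; exists m.
  have -> : XN ^+ m = 'X^m *: map_mx polyC (N ^+ m).
    elim: m {Nm} => [|m IH]; first by rewrite !expr0 map_mx1 scale1r.
    rewrite !exprS IH -!mulmxE map_mxM -scalemxAl -scalemxAr scalerA.
    by rewrite -exprS.
  by rewrite Nm map_mx0 scaler0.
have pq : \det a * \det (GLinvmx a) = 1 by rewrite -det_mulmx GLmulV det1.
have := poly_unit_eval1_nilpotent (leqnSn _) pq.
rewrite -horner_coef0 -![_.[_]]/(horner_eval _ _) -!det_map_mx aE.
have -> : map_mx (horner_eval 1) (1 + XN) = 1 + N.
  by apply/matrixP=> i j; rewrite !mxE /= /horner_eval !hornerE -polyC_natr hornerC.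
have -> : map_mx (horner_eval 0) (1 + XN) = 1.
  apply/matrixP=> i j; rewrite !mxE /= /horner_eval !hornerE.
  by rewrite -polyC_natr hornerC.
by rewrite det1.
Qed.

Lemma nilpotent_torsion k (u x : R) : u * k%:R = 1 -> nilpotent x ->
  (1 + x) ^+ k = 1 -> x = 0.
Proof.
case: k => [|k] uk [m xm]; first by move/eqP: uk; rewrite mulr0 eq_sym oner_eq0.
have [w ->] := exprD_linear_part 1 x k.
rewrite !expr1n mulr1 -addrA => /(congr1 (fun z => u * (z - 1))).
rewrite addrAC subrr add0r mulr0 mulrDr mulrA uk mul1r => e.
(* Expanding the power gives kx + x^2 w = 0; iterating the resulting identity puts arbitrarily high
   powers of x in x. *)
have {}e : x = x * (x * - (u * w)).
  by apply/eqP; rewrite -subr_eq0 -{}e; apply/eqP; ring.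
have -> : x = x * (x * - (u * w)) ^+ m.
  by elim: (m) => [|l IH]; rewrite ?expr0 ?mulr1 // exprS mulrA -e.
by rewrite exprMn xm mul0r mulr0.
Qed.

End UnipotentDeterminant.

(** * Local rings *)

Section LocalRing.
Variable A : comPzRingType.

Lemma maximal_ideal_exists (x : A) : ~ (exists y, y * x = 1) ->
  exists2 m : set A, maximal_ideal m & m x.
Proof.
move=> xN; pose hull (I : set A) : set A := fun z => I z \/ exists a, z = a * x.
pose P (I : set A) := ideal (hull I) /\ ~ hull I 1.
have [F FP Ftot|I [[hI hI1] Imax]] := @Zorn_bigcup A P.
  have hF z : hull (\bigcup_(X in F) X)%classic z ->
      (exists a, z = a * x) \/ exists2 X, F X & X z.
    by case=> [[X FX Xz]|zx]; [right; exists X|left].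
  split; [split|].
  - by right; exists 0; rewrite mul0r.
  - move=> y z /hF hy /hF hz.
    have up X w : F X -> hull X w -> hull (\bigcup_(X in F) X)%classic w.
      by move=> FX [Xw|wx]; [left; exists X|right].
    case: hy => [yx|[X FX Xy]]; case: hz => [zx|[Y FY Yz]].
    + case: yx zx => a -> [b ->]; right; exists (a + b); by rewrite mulrDl.
    + by have [[_ D _] _] := FP Y FY; apply: up FY _; apply: D; [right|left].
    + by have [[_ D _] _] := FP X FX; apply: up FX _; apply: D; [left|right].
    + have [XY|YX] := Ftot _ _ FX FY.
        by have [[_ D _] _] := FP Y FY; apply: up FY _; apply: D; left; [apply: XY|].
      by have [[_ D _] _] := FP X FX; apply: up FX _; apply: D; left; [|apply: YX].
  - move=> a z /hF[[b ->]|[X FX Xz]]; first by right; exists (a * b); rewrite mulrA.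
    have [[_ _ M] _] := FP X FX.
    have [|[b ->]] := M a z (or_introl Xz); last by right; exists b.
    by left; exists X.
  - move=> /hF[[b b1]|[X FX X1]]; first by apply: xN; exists b.
    by have [_ +] := FP X FX; apply; left.
have hullE (J : set A) : ideal J -> (hull I `<=` J)%classic -> hull J = J.
  move=> iJ IJ; apply/seteqP; split=> z; last by left.
  by case=> // zx; apply: IJ; right.
have xI : hull I x by right; exists 1; rewrite mul1r.
exists (hull I) => //; split=> // [IT|J iJ IJ]; first by apply: hI1; rewrite IT.
have [J1|J1] := pselect (J 1).
  right; apply/seteqP; split=> z // _; have [_ _ M] := iJ.
  by rewrite -[z]mulr1; apply: M.
left; apply/seteqP; split=> // z Jz; left; apply: contrapT => Iz.
apply: (Imax J); last by rewrite /P hullE.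
by split=> [w Iw|JI]; [apply: IJ; left|apply/Iz/JI].
Qed.

Lemma local_ring_unit : local_ring A -> exists m : set A,
  [/\ ideal m, ~ m 1 & forall x, ~ m x -> exists y, y * x = 1].
Proof.
case=> m [[im mT _] uniq_m]; exists m; split=> // [m1|x mx].
  apply: mT; apply/seteqP; split=> z // _; have [_ _ M] := im.
  by rewrite -[z]mulr1; apply: M.
apply: contrapT => /maximal_ideal_exists[M maxM Mx].
by apply: mx; rewrite (uniq_m M).
Qed.

Lemma mulmx_transvection n m (M : 'M[A]_(m, n)) (i j : 'I_n) x k :
  (M *m (1%:M + x *: delta_mx i j)) k j = M k j + x * M k i.
Proof.
rewrite mulmxDr mulmx1 -scalemxAr !mxE (bigD1 i) //= big1 ?addr0 => [|l li].
  by rewrite mxE !eqxx mulr1.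
by rewrite mxE (negPf li) mulr0.
Qed.

Lemma transvection_pivot n m (M : 'M[A]_(m, n)) (i j : 'I_n) k y :
    i != j -> y * M k i = 1 ->
  exists2 e, elementary e & (M *m e) k j = 1.
Proof.
move=> ij yM; exists (1%:M + ((1 - M k j) * y) *: delta_mx i j).
  exact: elementary_gen.
by rewrite mulmx_transvection -mulrA yM mulr1 addrC subrK.
Qed.

Lemma K1_local_descent n (a : GL A (n.+1 + 1)) : local_ring A ->
  exists b : GL A n.+1, K1_class a = K1_class b.
Proof.
case/local_ring_unit=> m [[m0 mD mM] m1 munit].
pose l : 'I_(n.+1 + 1) := rshift n.+1 ord0; pose z : 'I_(n.+1 + 1) := lshift 1 ord0.
have zl : z != l by rewrite eq_lrshift.
have lz : l != z by rewrite eq_rlshift.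
(* Otherwise the last row lies in the maximal ideal, and so does 1, its product with the last column
   of the inverse. *)
have [j [y yj]] : exists j y, y * a l j = 1.
  apply: contrapT => noj; apply: m1.
  have <- : \sum_j a l j * GLinvmx a j l = 1.
    have /matrixP/(_ l l) := GLmulV a.
    by rewrite !mxE eqxx.
  elim/big_ind: _ => // j _; rewrite mulrC; apply: mM.
  by apply: contrapT => /munit[y yj]; apply: noj; exists j, y.
have [e ee el] : exists2 e, elementary e & ((a : 'M_ _) *m e) l l = 1.
  have [jl|jl] := eqVneq j l; last exact: transvection_pivot jl yj.
  (* A unit already at (l, l) is normalised by passing through column z and back. *)
  rewrite jl in yj; have [e ee ez] := transvection_pivot lz yj.
  have [|f ef fl] := @transvection_pivot _ _ ((a : 'M_ _) *m e) z l l 1 zl.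
    by rewrite mul1r.
  by exists (e *m f); [apply: elementaryM|rewrite mulmxA].
pose M := (a : 'M_ _) *m e; pose B := ursubmx M; pose C := dlsubmx M.
have ME : M = block_mx (ulsubmx M) B C 1%:M.
  rewrite -[LHS]submxK; congr block_mx; apply/matrixP=> i i'.
  by rewrite !ord1 [RHS]mxE eqxx [LHS]mxE [LHS]mxE; apply: el.
(* The Schur complement of the corner entry 1. *)
pose d := ulsubmx M - B *m C.
have [b bE ba] : exists2 b : GL A (n.+1 + 1), b = stab (n.+1 + 1) d :> 'M_ _ &
    K1_class b = K1_class a.
  apply: (@K1_class_elementary_mul _ _ _ (leqnn _) a (block_mx 1%:M (- B) 0 1%:M)
    (e *m block_mx 1%:M 0 (- C) 1%:M)).
  - exact: elementary_ublock.
  - by apply: elementaryM => //; apply: elementary_lblock.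
  rewrite stab_id mulmxA -(mulmxA _ _ e) -/M ME stab_block !mulmx_block.
  rewrite !(mulmx0, mul0mx, mulmx1, mul1mx, addr0, add0r) mulNmx subrr.
  by rewrite mul0mx addr0 subrr.
have dV : d *m ulsubmx (GLinvmx b) = 1%:M.
  have := GLmulV b; rewrite bE stab_block -[GLinvmx b in LHS]submxK mulmx_block.
  rewrite !(mul0mx, addr0) [RHS]scalar_mx_block.
  by case/eq_block_mx.
exists (mkGL dV (mulmx1C dV)); rewrite -ba -(K1_class_stab (leq_addr 1 n.+1)).
by apply: K1_class_eq; rewrite bE.
Qed.

Lemma SK1_local (x : K1 A) : local_ring A -> x \in SK1 A -> x = 1%g.
Proof.
move=> locA; have [n [a ->]] := K1_class_surj x.
have [b ->] : exists b : GL A 1, K1_class a = K1_class b.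
  case: n a => [|n] a; first by exists (GLstab (leqnSn 0) a); rewrite K1_class_stab.
  elim: n a => [|n IH] a; first by exists a.
  move: a; rewrite -[n.+2]addn1 => a.
  by have [c ->] := K1_local_descent a locA; apply: IH.
rewrite SK1E => /eqP b1; rewrite -(K1_class_one A 1); apply: K1_class_eq.
by rewrite GLE -b1; apply/matrixP=> i j; rewrite !ord1 det_mx11 mxE eqxx.
Qed.

End LocalRing.

(** * Torsion in SK_1 of graded rings *)

Section DegreeZero.
Variables (R : comPzRingType) (G : grading R).

Definition degree0_proj (x : R) : degree0 G := Degree0 (hcomp_in G 0 x).

Lemma degree0_proj_zmod_morphism : zmod_morphism degree0_proj.
Proof. by move=> x y; apply: val_inj; rewrite raddfB /= raddfB. Qed.

Lemma degree0_proj_monoid_morphism : monoid_morphism degree0_proj.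
Proof.
split=> [|x y]; apply: val_inj; first by rewrite rmorph1 /= rmorph1.
by rewrite rmorphM /= rmorphM.
Qed.

HB.instance Definition _ := GRing.isZmodMorphism.Build R (degree0 G)
  degree0_proj degree0_proj_zmod_morphism.
HB.instance Definition _ := GRing.isMonoidMorphism.Build R (degree0 G)
  degree0_proj degree0_proj_monoid_morphism.

Lemma degree0_unit_nat k :
  (exists u : degree0 G, u * k%:R = 1) -> exists u : R, u * k%:R = 1.
Proof.
case=> u uk; exists (val u).
by have := congr1 val uk; rewrite rmorphM rmorph_nat rmorph1.
Qed.

End DegreeZero.

Section NonTrivial.
Variables (R : comNzRingType) (G : grading R) (k : nat) (u : R).
Hypothesis uk : u * k%:R = 1.

Lemma K1_unipotent_torsion n (N : 'M[R]_n) (hN : nilpotent_mx N) :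
    (K1_class (unipotent hN) ^+ k)%g = 1%g ->
  K1_class (unipotent hN) \in SK1 R /\
  K1_class (unipotent hN) = K1_class (unipotent (nilpotent_hcomp0 G hN)).
Proof.
move=> Nk; split; last first.
  rewrite (K1_graded_torsion G uk Nk); apply: K1_class_eq.
  by rewrite GLmapE !unipotentE /hcomp_mx map_mxD map_mx1.
have [b bE cb] := GL_exp (unipotent hN) k.
have : K1_class b \in SK1 R.
  by rewrite cb Nk -(K1_class_one R 0) SK1E det1.
rewrite !SK1E bE unipotentE => /eqP detk.
rewrite -subr_eq0; apply/eqP; apply: (nilpotent_torsion uk).
  exact: det_unipotent_nilpotent.
rewrite addrC subrK -detk; elim: (k) => [|l IH]; first by rewrite !expr0 det1.
by rewrite !exprS -mulmxE det_mulmx IH.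
Qed.

Lemma SK1_torsion_local (x : K1 R) : local_ring (degree0 G) ->
  x \in SK1 R -> (x ^+ k)%g = 1%g -> x = 1%g.
Proof.
move=> locG; have [n [a ->]] := K1_class_surj x.
rewrite SK1E => /eqP da ak; rewrite (K1_graded_torsion G uk ak).
(* The projection to degree 0 factors through R_0, where the class lies in SK_1 of a local ring. *)
have a0 : K1_class (GLmap (degree0_proj G) a) = 1%g.
  by apply: SK1_local => //; rewrite SK1E GLmapE det_map_mx da rmorph1.
rewrite -(K1_class_map1 (val : {rmorphism degree0 G -> R}) a0).
by apply: K1_class_eq; apply/matrixP=> i j; rewrite !mxE.
Qed.

End NonTrivial.

(* Polynomials are only defined over rings with 1 != 0. *)
Section NonZeroRing.
Variables (R : comPzRingType) (nz : 1 != 0 :> R).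

Definition comNzRing_of : comNzRingType :=
  HB.pack_for comNzRingType (GRing.ComPzRing.sort R)
    (GRing.PzSemiRing_isNonZero.Build R nz).

End NonZeroRing.

(** An equality of structures lets the grading and K_1 be carried over by substitution. *)
Lemma comNzRing_ofE (R : comPzRingType) (nz : 1 != 0 :> R) : R = comNzRing_of nz.
Proof. by case: R nz => T [*]. Qed.

Lemma K1_trivial (R : comPzRingType) (x : K1 R) : 1 = 0 :> R -> x = 1%g.
Proof.
move=> R0; have [n [a ->]] := K1_class_surj x.
rewrite -(K1_class_one R n); apply: K1_class_eq; apply/matrixP=> i j.
by rewrite -[LHS]mulr1 -[RHS]mulr1 R0 !mulr0.
Qed.

Theorem theorem1p3 (R : comPzRingType) (G : grading R) (k : nat)
    (k_ge1 : (1 <= k)%N)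
    (k_unit : exists u : degree0 G, u * k%:R = 1) :
  (forall (n d : nat) (N : 'M[R]_n) (hN : nilpotent_mx N),
     N = \sum_(i < d.+1) hcomp_mx G i N ->
     (K1_class (unipotent hN) ^+ k)%g = K1_class (GLone R n) ->
     K1_class (unipotent hN) \in SK1 R /\
     K1_class (unipotent hN) =
       K1_class (unipotent (nilpotent_hcomp0 G hN))) /\
  (reduced_ring (degree0 G) -> local_ring (degree0 G) ->
     forall x : K1 R, x \in SK1 R -> (x ^+ k)%g = 1%g -> x = 1%g).
Proof.
have [R0|nz] := eqVneq (1 : R) 0.
  split=> [n d N hN _ _|_ _ x _ _]; last exact: K1_trivial.
  split; last by rewrite [LHS]K1_trivial // [RHS]K1_trivial.
  by rewrite [K1_class _]K1_trivial // -(K1_class_one R 0) SK1E det1.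
have [u uk] := degree0_unit_nat k_unit.
have := comNzRing_ofE nz; move: (comNzRing_of nz) => R' eR; subst R.
split=> [n d N hN _|_ locG x]; last exact: (SK1_torsion_local uk locG).
by rewrite K1_class_one; apply: (K1_unipotent_torsion G uk).
Qed.
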